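(* Consider the inverse problem $y=Af$, a family of linear regularization operators $L^\lambda$ and its discretized version $\hat f^\lambda_n=\frac1n\sum_{i=1}^n\ell^\lambda_{X_i}Y_i$. Put $\varepsilon(\lambda)=\|f^\lambda-f^\dagger\|\,\|L^\lambda\|_{HS}^{-1}$. Then for each $n\in\mathbb N$ there exists a function $\Delta(n,\lambda)$ such that for each $0<\delta\le\Delta(n,\lambda)$ and each (infinite dimensional) noisy datum $y^\delta$ with $\|y^\delta-y\|\le\delta$, $$\|f^\lambda_\delta-f^\dagger\|^2\le\mathbb E\left(\|\hat f^\lambda_n-f^\dagger\|^2\right).\qquad(\ast)$$ Moreover, $$\Delta(n,\lambda)=\frac{1}{\sqrt{\frac{\sigma^2}{n}+\varepsilon(\lambda)^2}+\varepsilon(\lambda)}\,\frac{\sigma^2}{n}.$$ Conversely, for each $\delta>0$ there exists a function $N(\delta,\lambda)$ such that for each $n\in\mathbb N$ with $n\le N(\delta,\lambda)$ the inequality $(\ast)$ holds (for each $y^\delta$ with $\|y^\delta-y\|\le\delta$), and $$N(\delta,\lambda)=\frac{\sigma^2}{\delta^2+2\delta\varepsilon(\lambda)}.$$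
   Context: Setting. $\mathcal H_1=L^2(\mathcal T,\mu)$ for a measure space $(\mathcal T,\Theta,\mu)$ and $\mathcal H_2=L^2(\mathcal X,\nu)$ for a measure space $(\mathcal X,\Sigma,\nu)$; $A:\mathcal H_1\to\mathcal H_2$ is a bounded linear operator. $(L^\lambda)_{\lambda>0}$ is a family of linear regularization operators $\mathcal H_2\to\mathcal H_1$ for $A$, of the form $L^\lambda z=\int_{\mathcal X}\ell^\lambda_x\,z(x)\,d\nu(x)$, where $\ell^\lambda_x\in\mathcal H_1$ for each $x\in\mathcal X$, $\ell^\lambda_x(t)=\ell^\lambda(x,t)$, $\ell^\lambda(\cdot,t)\in\mathcal H_2$ for each $t\in\mathcal T$, and $\sup_{t\in\mathcal T}\|\ell^\lambda(\cdot,t)\|_{\mathcal H_2}<\infty$. $\|\cdot\|_{HS}$ is the Hilbert–Schmidt norm. $f^\lambda=L^\lambda y$ is the regularized solution for the exact data $y$, and $f^\lambda_\delta=L^\lambda y^\delta$ the one for noisy data $y^\delta\in\mathcal H_2$. Samples. The observations $(X_i,Y_i)$, $i=1,\dots,n$, are i.i.d. from a probability distribution $\rho$ on a Borel space $\mathcal X\times\mathcal Y$, $\mathcal Y\subseteq\mathbb R$, whose marginal on $\mathcal X$ is $\nu$ (so $\nu$ is a probability measure); for $\nu$-almost every $x$, $\mathbb E(Y|X=x)=Af^\dagger(x)=y(x)$, where $f^\dagger\in\mathcal H_1$ is the generalized (minimum-norm least-squares) solution of $y=Af$, and $Var(Y|X=x)=\sigma^2$ with $\sigma$ constant. $\mathbb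 E$ is the expectation with respect to $\rho^{\otimes n}$. *)

(* Defs.v *)
(* MathComp-Analysis. *)
From HB Require Import structures.
From mathcomp Require Import all_boot all_order all_algebra.
From mathcomp Require Import all_classical all_reals all_analysis.

Set Implicit Arguments.
Unset Strict Implicit.
Unset Printing Implicit Defensive.
Import Order.TTheory GRing.Theory Num.Theory.
Import numFieldNormedType.Exports.

Local Open Scope classical_set_scope.
Local Open Scope ring_scope.

(* Elements of [L2 mu] are square-integrable functions, not classes modulo
   a.e. equality (the quotient carries no vector space structure in the
   library).  [l2norm] is therefore a seminorm, and equality of vectors is
   stated as equality a.e. *)
Definition L2 d (T : measurableType d) (R : realType)
  (mu : {measure set T -> \bar R}) := LfunType mu (lee1n 2).

Section L2_theory.
Context d (T : measurableType d) (R : realType).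
Variable mu : {measure set T -> \bar R}.

Definition l2norm (f : L2 mu) : R := fine ('N[mu]_2%:E[EFin \o f])%E.

Definition l2dot (f g : L2 mu) : R := \int[mu]_t (f t * g t).

Definition orthonormal_basis (I : choiceType) (e : I -> L2 mu) : Prop :=
  (forall i j, l2dot (e i) (e j) = (i == j)%:R) /\
  (forall (z : L2 mu) (eta : R), 0 < eta ->
    exists (s : seq I) (c : I -> R),
      l2norm (z - \sum_(i <- s) c i *: e i) < eta).

End L2_theory.

Section operators.
Context d1 d2 (T : measurableType d1) (X : measurableType d2) (R : realType).
Variables (mu : {measure set T -> \bar R}) (nu : {measure set X -> \bar R}).

(* Linearity holds in the quotient space; together with boundedness it implies
   that [A] maps a.e. equal functions to a.e. equal functions. *)
Definition bounded_linear_operator (A : L2 mu -> L2 nu) : Prop :=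
  (forall (a : R) (f g : L2 mu),
    (A (a *: f + g) : X -> R) = (a *: A f + A g : L2 nu) %[ae nu]) /\
  (exists C : R, forall f : L2 mu, l2norm (A f) <= C * l2norm f).

Definition least_squares_solution (A : L2 mu -> L2 nu) (z : L2 nu)
    (f : L2 mu) : Prop :=
  forall g : L2 mu, l2norm (A f - z) <= l2norm (A g - z).

Definition generalized_solution (A : L2 mu -> L2 nu) (z : L2 nu)
    (f : L2 mu) : Prop :=
  least_squares_solution A z f /\
  (forall g : L2 mu, least_squares_solution A z g -> l2norm f <= l2norm g).

End operators.

Section regularization.
Context d1 d2 (T : measurableType d1) (X : measurableType d2) (R : realType).
Variables (mu : {measure set T -> \bar R}) (nu : {measure set X -> \bar R}).

(* Bounded linear operators converging pointwise to the generalized inverse of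
   [A] on its domain, i.e. on the data having a generalized solution. *)
Definition linear_regularization (A : L2 mu -> L2 nu)
    (L : R -> L2 nu -> L2 mu) : Prop :=
  (forall lam : R, 0 < lam -> bounded_linear_operator (L lam)) /\
  (forall (z : L2 nu) (f : L2 mu), generalized_solution A z f ->
    l2norm (L lam z - f) @[lam --> 0^'+] --> (0 : R)).

Definition is_kernel_of (L : L2 nu -> L2 mu) (l : X -> L2 mu) : Prop :=
  [/\ measurable_fun [set: X * T] (fun p : X * T => l p.1 p.2),
      forall t : T, (fun x => l x t) \in Lfun nu 2%:E,
      (ereal_sup [set 'N[nu]_2%:E[EFin \o (fun x => l x t)] | t in [set: T]]
         < +oo)%E &
      forall z : L2 nu,
        (L z : T -> R) = (fun t => \int[nu]_x (l x t * z x)) %[ae mu]].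

(* The value does not depend on the orthonormal basis [e] of the domain; it is
   [+oo] when [L] is not a Hilbert-Schmidt operator.  In a formula containing
   [(fine (hs_norm e L))^-1] this inverse is then 0, and it is also 0 when
   [L] = 0. *)
Definition hs_norm (I : choiceType) (e : I -> L2 nu)
    (L : L2 nu -> L2 mu) : \bar R :=
  sqrte (\esum_(i in [set: I]) (l2norm (L (e i)) ^+ 2)%:E)%E.

End regularization.

Section sampling.
Context d (Z : measurableType d) (R : realType).
Variable rho : probability Z R.

Definition cons_pair n (w : Z * n.-tuple Z) : n.+1.-tuple Z :=
  [the n.+1.-tuple Z of w.1 :: w.2].

Lemma measurable_cons_pair n : measurable_fun setT (@cons_pair n).
Proof. by apply: measurable_cons. Qed.

HB.instance Definition _ n :=
  isMeasurableFun.Build _ _ _ _ (@cons_pair n) (@measurable_cons_pair n).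

(* The law on [n.-tuple Z] of [n] independent draws from [rho]. *)
Fixpoint product_power n : probability (n.-tuple Z) R :=
  match n with
  | 0 => \d_([tuple])
  | m.+1 => distribution (rho \x product_power m)%E (@cons_pair m)
  end.

End sampling.

Section regression.
Context d (X : measurableType d) (R : realType).
Variable rho : probability (X * measurableTypeR R)%type R.

(* [m] is a version of x |-> E(g(X, Y) | X = x) for (X, Y) distributed as
   [rho]. *)
Definition conditional_expectation (g : X * measurableTypeR R -> R)
    (m : X -> R) : Prop :=
  [/\ rho.-integrable setT (EFin \o g),
      measurable_fun setT m,
      rho.-integrable setT (fun w => (m w.1)%:E) &
      forall B : set X, measurable B ->
        (\int[rho]_(w in fst @^-1` B) (g w)%:E =
         \int[rho]_(w in fst @^-1` B) (m w.1)%:E)%E].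

End regression.

Section estimator.
Context d1 d2 (T : measurableType d1) (X : measurableType d2) (R : realType).
Variable mu : {measure set T -> \bar R}.

Definition discretized_estimator (l : X -> L2 mu) n
    (s : n.-tuple (X * measurableTypeR R)%type) : L2 mu :=
  n%:R^-1 *: \sum_(i < n) (((tnth s i).2 : R) *: l (tnth s i).1).

End estimator.

(* Main.v *)
Require Import Defs.
From HB Require Import structures.
From mathcomp Require Import all_boot all_order all_algebra.
From mathcomp Require Import all_classical all_reals all_analysis.
From mathcomp Require Import measurable_realfun ring lra.

Set Implicit Arguments.
Unset Strict Implicit.
Unset Printing Implicit Defensive.
Import Order.TTheory GRing.Theory Num.Theory.
Import numFieldNormedType.Exports.

Local Open Scope classical_set_scope.
Local Open Scope ring_scope.

(** The risk of the discretized estimator splits into bias and variance: writing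
    b for the bias |L y - f|, the expected squared error is b^2 plus 1/n times
    the variance of one term Y l(X, .).  That variance is at least
    sigma^2 times K, where K is the integral over t of |l(., t)|^2: the variance
    of Y given X contributes exactly sigma^2 K, and the variability of X can
    only add to it.  On the other side, Cauchy-Schwarz in each slice l(., t)
    gives |L z - L y|^2 <= delta^2 K, so the noisy datum has squared error at
    most (b + delta sqrt K)^2.  The comparison therefore reduces to
    delta^2 + 2 delta b / sqrt K <= sigma^2 / n, and this is what both threshold
    functions express with the Hilbert-Schmidt norm in place of sqrt K.

    Three points need care.

    - Tonelli's theorem and even the measurability of the loss may fail if [mu]
      is not sigma-finite.  Only finitely many square-integrable functions matter
      in each estimate, so [mu] is replaced by its restriction to the union of
      their supports ([sigma_finite_reduction]).  The expectation is then only
      bounded from below ([risk_lower_bound]), which is the direction required.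

    - The squared Hilbert-Schmidt norm is the supremum of the finite sums of the
      |L e_i|^2, and each finite sum is at most K by Bessel's inequality in each
      slice ([l2_bessel], [risk_decomposition]).  So the bound on the risk holds
      with the square q of the Hilbert-Schmidt norm as well as with K, and
      [bias_noise_tradeoff] only needs these two bounds.  An admissible
      delta > 0 forces sigma to be nonzero, and then a finite risk forces a
      finite q.  When q = 0 the operator
      vanishes on a total family, hence everywhere
      ([operator_vanishes_on_basis]), and the noise has no effect.

    - Pointwise in t, the lower bound on the risk of a single draw
      ([single_draw_risk]) is stated with values in the extended reals, so that
      Y l(X, t) may fail to be square-integrable; it propagates to n
      independent draws by induction ([sample_sum_risk]). *)

(** * Square-integrable functions *)

Section L2_facts.
Context d (T : measurableType d) (R : realType).
Variable mu : {measure set T -> \bar R}.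
Implicit Types f g : L2 mu.

Lemma L2_measurable f : measurable_fun [set: T] (f : T -> R).
Proof. by []. Qed.

Lemma l2norm_ge0 f : 0 <= l2norm f.
Proof. by apply: fine_ge0; exact: Lnorm_ge0. Qed.

Lemma l2normD f g : l2norm (f + g) <= l2norm f + l2norm g.
Proof. exact: ler_LnormD. Qed.

Lemma l2norm_sqr f :
  ((l2norm f ^+ 2)%:E = \int[mu]_t (f t ^+ 2)%:E)%E.
Proof.
rewrite -powR_mulrn ?l2norm_ge0// -poweR_EFin finite_norm_fine.
rewrite poweR_Lnorm//; apply: eq_integral => t _ /=.
by rewrite powR_mulrn ?normr_ge0// -normrX ger0_norm ?sqr_ge0.
Qed.

Lemma l2normZ (a : R) f : l2norm (a *: f) = `|a| * l2norm f.
Proof.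
apply: EFin_inj; rewrite EFinM !finite_norm_fine -LnormZ.
by [].
Qed.

Lemma eq_l2norm f g : (f : T -> R) = g %[ae mu] -> l2norm f = l2norm g.
Proof.
move=> fg; apply/eqP; rewrite -(@eqrXn2 _ 2) ?l2norm_ge0//; apply/eqP.
apply: EFin_inj; rewrite !l2norm_sqr.
apply: ae_eq_integral => //.
- exact/measurable_EFinP/measurable_funX.
- exact/measurable_EFinP/measurable_funX.
- by apply: filterS fg => t /= /(_ I) ->.
Qed.

Lemma integrable_mul_L2 f g :
  mu.-integrable [set: T] (fun t => (f t * g t)%:E).
Proof. by apply/Lfun1_integrable/Lfun2_mul_Lfun1; exact: LfunP. Qed.

Lemma l2dot_norm f : l2dot f f = l2norm f ^+ 2.
Proof. by rewrite /l2dot /Rintegral -[RHS]/(fine (_%:E)) l2norm_sqr. Qed.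

Lemma l2dotC f g : l2dot f g = l2dot g f.
Proof. by apply: eq_Rintegral => t _; rewrite mulrC. Qed.

Lemma l2dotZD (a : R) f g h : l2dot (a *: f + g) h = a * l2dot f h + l2dot g h.
Proof.
rewrite /l2dot -RintegralZl//; last exact: integrable_mul_L2.
rewrite -RintegralD//; last 2 first.
- exact: (integrableZl measurableT a (integrable_mul_L2 f h)).
- exact: integrable_mul_L2.
by apply: eq_Rintegral => t _ /=; rewrite mulrDl mulrA.
Qed.

Lemma l2dotB f g h : l2dot f (g - h) = l2dot f g - l2dot f h.
Proof.
rewrite l2dotC addrC -scaleN1r l2dotZD mulN1r addrC.
by rewrite !(l2dotC f).
Qed.

(** Cauchy-Schwarz, the case p = q = 2 of Hoelder. *)
Lemma l2dot_le f g : `|l2dot f g| <= l2norm f * l2norm g.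
Proof.
apply: (le_trans (le_normr_Rintegral measurableT (integrable_mul_L2 f g))).
rewrite -lee_fin /Rintegral fineK; last first.
  apply: integrable_fin_num => //.
  exact/(integrable_norm (integrable_mul_L2 f g)).
rewrite EFinM !finite_norm_fine.
rewrite -[leLHS](Lnorm1 mu (fun t => (f t * g t)%:E)).
by apply: hoelder => //; rewrite [RHS]splitr !div1r.
Qed.

End L2_facts.

Section Bessel.
Context d (T : measurableType d) (R : realType).
Variable mu : {measure set T -> \bar R}.

Lemma l2dot_suml (I : Type) (s : seq I) (c : I -> R) (e : I -> L2 mu)
    (g : L2 mu) :
  l2dot (\sum_(i <- s) c i *: e i) g = \sum_(i <- s) c i * l2dot (e i) g.
Proof.
elim: s => [|i s IHs]; last by rewrite !big_cons l2dotZD IHs.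
have := l2dotB g 0 0; rewrite !big_nil subr0 l2dotC => /eqP.
by rewrite subrr => /eqP.
Qed.

(** Bessel's inequality: the projection of [g] on the span of the [e i] has
    squared norm equal to the sum, and subtracting it from [g] leaves a vector
    of nonnegative squared norm. *)
Lemma l2_bessel (I : choiceType) (e : I -> L2 mu) (s : seq I) (g : L2 mu) :
  (forall i j, l2dot (e i) (e j) = (i == j)%:R) -> uniq s ->
  \sum_(i <- s) l2dot (e i) g ^+ 2 <= l2norm g ^+ 2.
Proof.
move=> eON us; pose c i := l2dot (e i) g.
pose u := \sum_(i <- s) c i *: e i.
have gu : l2dot g u = \sum_(i <- s) c i ^+ 2.
  by rewrite l2dotC l2dot_suml; apply: eq_bigr => i _; rewrite expr2.
have uu : l2dot u u = \sum_(i <- s) c i ^+ 2.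
  rewrite l2dot_suml big_seq [RHS]big_seq; apply: eq_bigr => i si.
  rewrite l2dotC l2dot_suml (bigD1_seq i)//= eON eqxx mulr1 expr2.
  by rewrite big1 ?addr0// => j ji; rewrite eON (negbTE ji) mulr0.
have guu : l2norm (g - u) ^+ 2 = l2norm g ^+ 2 - l2dot g u.
  rewrite -l2dot_norm l2dotB (l2dotC _ g) (l2dotC _ u) !l2dotB.
  by rewrite (l2dotC u) gu uu l2dot_norm subrr subr0.
by rewrite -gu -subr_ge0 -guu sqr_ge0.
Qed.

End Bessel.

Lemma Lfun2_sqr_lty d (T : measurableType d) (R : realType)
    (mu : {measure set T -> \bar R}) (f : T -> R) :
  measurable_fun [set: T] f -> (\int[mu]_t (f t ^+ 2)%:E < +oo)%E ->
  f \in Lfun mu 2%:E.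
Proof.
move=> mf foo; apply/andP; split; rewrite inE//= /finite_norm.
apply: (@lty_poweRy _ _ 2) => //; rewrite poweR_Lnorm//.
apply: le_lt_trans foo; rewrite le_eqVlt; apply/orP; left; apply/eqP.
apply: eq_integral => t _ /=.
by rewrite powR_mulrn ?normr_ge0// -normrX ger0_norm ?sqr_ge0.
Qed.

Lemma L2_of_Lfun d (T : measurableType d) (R : realType)
    (mu : {measure set T -> \bar R}) (f : T -> R) :
  f \in Lfun mu 2%:E -> exists g : L2 mu, forall t, g t = f t.
Proof. by move=> lf; exists (Lfun_Sub (lee1n 2) lf). Qed.

(** Cauchy-Schwarz against the constant 1. *)
Lemma Rintegral_sqr_le d (T : measurableType d) (R : realType)
    (P : probability T R) (f : L2 P) :
  (\int[P]_t f t) ^+ 2 <= l2norm f ^+ 2.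
Proof.
have [one oneE] := L2_of_Lfun (Lfun_cst P 1 2).
have f1 : \int[P]_t f t = l2dot f one.
  by apply: eq_Rintegral => t _ /=; rewrite oneE mulr1.
have one1 : l2norm one ^+ 2 = 1.
  apply: EFin_inj.
  rewrite (@l2norm_sqr _ _ _ P one) /= -(@probability_setT _ _ _ P).
  under eq_integral do rewrite oneE expr1n.
  by rewrite integral_cst// mul1e.
rewrite f1 -[leRHS]mulr1 -one1 -exprMn -real_normK ?num_real//.
by rewrite lerXn2r ?nnegrE ?normr_ge0 ?mulr_ge0 ?l2norm_ge0// l2dot_le.
Qed.

(** * Reduction to a sigma-finite measure *)

Section sigma_finite_reduction.
Context d (T : measurableType d) (R : realType).
Variable mu : {measure set T -> \bar R}.

(** The sum of squares of the given functions is integrable, so by Markov's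
    inequality its support is a countable union of sets of finite measure;
    [mu'] is the restriction of [mu] to this support. *)
Lemma sigma_finite_reduction (s : seq (L2 mu)) :
  exists mu' : {sigma_finite_measure set T -> \bar R},
    (forall A, measurable A -> (mu' A <= mu A)%E) /\
    (forall g, g \in s ->
      (\int[mu']_t (g t ^+ 2)%:E = \int[mu]_t (g t ^+ 2)%:E)%E).
Proof.
pose G t := \sum_(g <- s) g t ^+ 2.
have G0 t : 0 <= G t by apply: sumr_ge0 => g _; exact: sqr_ge0.
have mG : measurable_fun setT G.
  by apply: measurable_sum => g; exact/measurable_funX.
have iG : mu.-integrable setT (EFin \o G).
  rewrite (_ : _ \o _ = fun t => (\sum_(g <- s) (g t ^+ 2)%:E)%E); last first.
    by apply/funext => t; rewrite /G /= sumEFin.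
  by apply: integrable_sum => // g _; apply: Lfun2_integrable_sqr; exact: LfunP.
pose S := [set t | 0 < G t].
have mS : measurable S.
  rewrite (_ : S = G @^-1` `]0, +oo[); last first.
    by apply/seteqP; split=> t; rewrite /S/= in_itv/= andbT.
  by rewrite -[X in measurable X]setTI; exact: mG.
pose F n := if n is m.+1 then [set t | m.+1%:R^-1 <= G t] else ~` S.
have mF n : measurable (F n).
  case: n => [|n] /=; first exact: measurableC.
  rewrite (_ : [set _ | _] = G @^-1` `[n.+1%:R^-1, +oo[); last first.
    by apply/seteqP; split=> t; rewrite /= in_itv/= andbT.
  by rewrite -[X in measurable X]setTI; exact: mG.
have sF : sigma_finite setT (mrestr mu mS).
  exists F => [|n].
    apply/seteqP; split=> t //= _.
    have [St|St] := pselect (S t); last by exists 0%N.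
    exists (Num.truncn (G t)^-1).+1 => //=.
    rewrite invf_ple ?posrE//.
    by rewrite ltW// truncnS_gt.
  split=> //; case: n => [|n] /=; rewrite /mrestr.
    by rewrite setICl measure0 ltry.
  have n0 : (0 : R) < n.+1%:R^-1 by rewrite invr_gt0.
  have := le_integral_abse mu measurableT (measurable_int _ iG) n0.
  have /integrableP[_ /[swap] Gn Goo] := iG.
  pose B := [set t | (n.+1%:R^-1%:E <= `|(EFin \o G) t|)%E].
  have Boo : (n.+1%:R^-1%:E * mu B < +oo)%E.
    by have := le_lt_trans Gn Goo; rewrite setTI.
  change (mu (F n.+1 `&` S) < +oo)%E.
  have mB : measurable B.
    rewrite (_ : B = F n.+1)//; apply/seteqP.
    by split=> t; rewrite /B/= lee_fin ger0_norm.
  have FB : (mu (F n.+1 `&` S) <= mu B)%E.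
    rewrite le_measure ?inE//; first exact: measurableI.
    by move=> t [] /=; rewrite /B/= lee_fin ger0_norm.
  apply: (le_lt_trans FB); rewrite ltNge leye_eq; apply/negP => /eqP Boo'.
  by move: Boo; rewrite Boo' gt0_muley ?lte_fin.
pose mu' : {sigma_finite_measure set T -> \bar R} :=
  HB.pack (mrestr mu mS) (Measure_isSigmaFinite.Build _ _ _ (mrestr mu mS) sF).
exists mu'; split=> [A mA | g gs].
  by rewrite /= /mrestr le_measure ?inE//; exact: measurableI.
have gS : (fun t => (g t ^+ 2)%:E) = (fun t => (g t ^+ 2)%:E) \_ S.
  apply/funext => t; rewrite patchE; case: ifPn => //.
  rewrite notin_setE /S /= => /negP; rewrite -leNgt => Gt.
  have {Gt} : G t = 0 by apply/eqP; rewrite eq_le Gt G0.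
  move=> /eqP; rewrite /G psumr_eq0; last by move=> *; exact: sqr_ge0.
  by move=> /allP/(_ g gs)/= /eqP ->.
rewrite gS -!integral_mkcond.
apply: eq_measure_integral => A mA AS /=.
by rewrite /mrestr setIidl.
Qed.

End sigma_finite_reduction.

(** * Integrals against functions of a component *)

Section integral_against_fibers.
Context d1 d2 (Z : measurableType d1) (X : measurableType d2) (R : realType).
Variables (mu : {measure set Z -> \bar R}) (p : Z -> X).
Hypothesis mp : measurable_fun [set: Z] p.
Variables f g : Z -> R.
Hypotheses (f0 : forall z, 0 <= f z) (g0 : forall z, 0 <= g z).
Hypotheses (mf : measurable_fun [set: Z] f) (mg : measurable_fun [set: Z] g).
Hypothesis fg : forall B, measurable B ->
  (\int[mu]_(z in p @^-1` B) (f z)%:E = \int[mu]_(z in p @^-1` B) (g z)%:E)%E.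

Import HBNNSimple.

Let integral_nnsfunM (h : {nnsfun X >-> R}) (k : Z -> R) :
  (forall z, 0 <= k z) -> measurable_fun [set: Z] k ->
  (\int[mu]_z (h (p z) * k z)%:E =
   \sum_(r \in range h)
     r%:E * \int[mu]_(z in p @^-1` (h @^-1` [set r])) (k z)%:E)%E.
Proof.
move=> k0 mk.
have mh r : measurable (p @^-1` (h @^-1` [set r])).
  by rewrite -[X in measurable X]setTI; exact: mp.
transitivity (\int[mu]_z
    (\sum_(r \in range h) (r * \1_(h @^-1` [set r]) (p z))%:E * (k z)%:E))%E.
  apply: eq_integral => z _; rewrite -ge0_mule_fsuml; last first.
    by move=> r; rewrite EFinM; exact: nnfun_muleindic_ge0.
  by rewrite fsumEFin// -fimfunE.
rewrite ge0_integral_fsum//; last 2 first.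
- move=> r; apply: emeasurable_funM; apply/measurable_EFinP => //.
  by apply: measurable_funM => //; exact: measurableT_comp.
- move=> r z _; apply: mule_ge0; last by rewrite lee_fin.
  by rewrite EFinM; exact: nnfun_muleindic_ge0.
apply: eq_fsbigr => r; rewrite inE => -[x _ <-].
rewrite [X in (_ * X)%E]integral_mkcond -ge0_integralZl//; last 3 first.
- apply/(measurable_restrictT _ (mh _))/measurable_funTS.
  exact/measurable_EFinP.
- by move=> z _; apply: erestrict_ge0 => t _; rewrite lee_fin.
- by rewrite lee_fin.
apply: eq_integral => z _; rewrite patchE indicE EFinM -muleA; congr (_ * _)%E.
rewrite (_ : (p z \in _) = (z \in p @^-1` (h @^-1` [set h x])))//.
by case: ifPn => _; rewrite ?mul1e ?mul0e.
Qed.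

(** If [f] and [g] have the same integrals over the fibres of [p], then they have
    the same integrals against any nonnegative weight factoring through [p], by
    approximating the weight by simple functions.  This turns the definition of
    a conditional expectation, which only mentions sets, into the identity
    E(h(X) g) = E(h(X) E(g | X)). *)
Lemma integral_fiber_weight (h : X -> R) :
  (forall x, 0 <= h x) -> measurable_fun [set: X] h ->
  (\int[mu]_z (h (p z) * f z)%:E = \int[mu]_z (h (p z) * g z)%:E)%E.
Proof.
move=> h0 /measurable_EFinP mh; pose a := nnsfun_approx measurableT mh.
have approx (k : Z -> R) : (forall z, 0 <= k z) -> measurable_fun [set: Z] k ->
    (\int[mu]_z (h (p z) * k z)%:E =
     limn (fun n => \int[mu]_z (a n (p z) * k z)%:E))%E.
  move=> k0 mk; rewrite -monotone_convergence//; last 3 first.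
  - move=> n; apply/measurable_EFinP; apply: measurable_funM => //.
    exact: measurableT_comp.
  - by move=> n z _; rewrite lee_fin mulr_ge0.
  - move=> z _ m n mn; rewrite lee_fin ler_wpM2r//.
    exact/lefP/nd_nnsfun_approx.
  apply: eq_integral => z _; apply/esym/cvg_lim => //.
  under eq_fun do rewrite EFinM; rewrite EFinM.
  apply: cvgeZr => //.
  by apply: (cvg_nnsfun_approx measurableT mh) => // x _; rewrite lee_fin.
rewrite !approx//; congr (limn _); apply/funext => n.
rewrite !integral_nnsfunM//; apply: eq_fsbigr => r _.
by rewrite fg.
Qed.

End integral_against_fibers.

(** * One observation of the regression model *)

Lemma norm_funrpos_le (T : Type) (R : realDomainType) (f : T -> R) (t : T) :
  `|f^\+ t| <= `|f t|.
Proof.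
by rewrite ger0_norm ?funrpos_ge0// /funrpos ge_max normr_ge0 ler_norm.
Qed.

Lemma norm_funrneg_le (T : Type) (R : realDomainType) (f : T -> R) (t : T) :
  `|f^\- t| <= `|f t|.
Proof.
by rewrite ger0_norm ?funrneg_ge0// /funrneg ge_max normr_ge0 -normrN ler_norm.
Qed.

Section regression_draw.
Context d (X : measurableType d) (R : realType).
Variables (nu : probability X R).
Variable rho : probability (X * measurableTypeR R)%type R.
Hypothesis hmarginal :
  forall B : set X, measurable B -> rho (fst @^-1` B) = nu B.
Variables (y : L2 nu) (sigma : R).
Hypothesis hmean : conditional_expectation rho (fun w => w.2) y.
Hypothesis hvar : conditional_expectation rho (fun w => (w.2 - y w.1) ^+ 2)
                    (fun=> sigma ^+ 2).

Notation Z := (X * measurableTypeR R)%type.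

Let measurable_comp_fst (h : X -> R) :
  measurable_fun [set: X] h -> measurable_fun [set: Z] (fun w => h w.1).
Proof. by move=> mh; exact: measurableT_comp. Qed.

Let measurable_residual : measurable_fun [set: Z] (fun w : Z => w.2 - y w.1).
Proof.
apply: measurable_funB; first exact: measurable_snd.
exact: measurable_comp_fst.
Qed.

Let pushforward_fst (B : set X) : measurable B -> pushforward rho fst B = nu B.
Proof. exact: hmarginal. Qed.

Lemma ge0_integral_fst (h : X -> R) :
  (forall x, 0 <= h x) -> measurable_fun [set: X] h ->
  (\int[rho]_w (h w.1)%:E = \int[nu]_x (h x)%:E)%E.
Proof.
move=> h0 mh; rewrite -[LHS](@ge0_integral_pushforward _ _ _ _ _ fst _ rho
  setT (EFin \o h))//.
- by apply: eq_measure_integral => B mB _; exact: pushforward_fst.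
- exact/measurable_EFinP.
- by move=> x _; rewrite lee_fin.
Qed.

Lemma integrable_fst (h : X -> R) :
  nu.-integrable [set: X] (EFin \o h) ->
  rho.-integrable [set: Z] (fun w => (h w.1)%:E).
Proof.
move=> /integrableP[/measurable_EFinP mh hoo]; apply/integrableP; split.
  by apply/measurable_EFinP; exact: measurable_comp_fst.
rewrite (ge0_integral_fst (h := fun x => `|h x|))//.
exact: measurableT_comp.
Qed.

Lemma Rintegral_fst (h : X -> R) :
  nu.-integrable [set: X] (EFin \o h) ->
  \int[rho]_w h w.1 = \int[nu]_x h x.
Proof.
move=> ih; rewrite /Rintegral; congr fine.
rewrite -[LHS](@integral_pushforward _ _ _ _ _ fst _ rho setT (EFin \o h))//.
- by apply: eq_measure_integral => B mB _; exact: pushforward_fst.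
- exact: measurable_int ih.
- by rewrite preimage_setT; exact: integrable_fst.
Qed.

(* The positive and the negative part of Y - y(X) are compared, because
   [integral_fiber_weight] only applies to nonnegative functions. *)
Let residual_balance (B : set X) : measurable B ->
  (\int[rho]_(w in fst @^-1` B) ((fun v : Z => v.2 - y v.1)^\+ w)%:E =
   \int[rho]_(w in fst @^-1` B) ((fun v : Z => v.2 - y v.1)^\- w)%:E)%E.
Proof.
move=> mB; have [iY my iy /(_ B mB) Yy] := hmean.
have mB1 : measurable (fst @^-1` B : set Z).
  by rewrite -[X in measurable X]setTI; exact: measurable_fst.
have {}iY := integrableS measurableT mB1 (@subsetT _ _) iY.
have {}iy := integrableS measurableT mB1 (@subsetT _ _) iy.
have iD : rho.-integrable (fst @^-1` B) (EFin \o (fun w : Z => w.2 - y w.1)).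
  exact: (integrableB mB1 iY iy).
have D0 : (\int[rho]_(w in fst @^-1` B) ((fun w : Z => w.2 - y w.1) w)%:E = 0)%E.
  rewrite (@integralB_EFin _ _ _ rho _ (fun w => w.2) (fun w => y w.1) mB1)//.
  by rewrite /= Yy subee//; exact: integrable_fin_num.
have sub0 (a b : \bar R) : a \is a fin_num -> b \is a fin_num ->
    (a - b = 0)%E -> a = b.
  by case: a b => [a||] [b||]// _ _ [] /eqP; rewrite subr_eq0 => /eqP ->.
have := integrable_pos_fin_num mB1 iD; have := integrable_neg_fin_num mB1 iD.
rewrite integralE in D0; move: D0; rewrite funerpos funerneg => D0 fn fp.
exact: sub0.
Qed.

Let residual_centered_ge0 (k : X -> R) : (forall x, 0 <= k x) ->
  measurable_fun [set: X] k ->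
  rho.-integrable [set: Z] (fun w : Z => (k w.1 * (w.2 - y w.1))%:E) ->
  \int[rho]_w (k w.1 * (w.2 - y w.1)) = 0.
Proof.
move=> k0 mk ikD; pose D (w : Z) := w.2 - y w.1.
have dominated (E : Z -> R) : measurable_fun [set: Z] E ->
    (forall w, `|E w| <= `|D w|) ->
    rho.-integrable [set: Z] (EFin \o (fun w => k w.1 * E w)).
  move=> mE ED; apply: le_integrable ikD => //.
    apply/measurable_EFinP/measurable_funM => //.
    exact: measurable_comp_fst.
  by move=> w _; rewrite /= lee_fin !normrM ler_wpM2l.
have ip := dominated D^\+ (measurable_funrpos measurable_residual)
  (norm_funrpos_le D).
have im := dominated D^\- (measurable_funrneg measurable_residual)
  (norm_funrneg_le D).
transitivity (\int[rho]_w (k w.1 * D^\+ w - k w.1 * D^\- w)).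
  apply: eq_Rintegral => w _; rewrite -mulrBr; congr (_ * _).
  by rewrite -[LHS]/(D w) -{1}[D]funrposBneg.
rewrite RintegralB//.
rewrite /Rintegral (@integral_fiber_weight _ _ _ _ _ rho fst measurable_fst
  D^\+ D^\- _ _ _ _ residual_balance k)// ?subrr//.
- exact: measurable_funrpos.
- exact: measurable_funrneg.
Qed.

Lemma residual_centered (h : X -> R) : measurable_fun [set: X] h ->
  rho.-integrable [set: Z] (fun w : Z => (h w.1 * (w.2 - y w.1))%:E) ->
  \int[rho]_w (h w.1 * (w.2 - y w.1)) = 0.
Proof.
move=> mh ihD; pose D (w : Z) := w.2 - y w.1.
have dominated (k : X -> R) : measurable_fun [set: X] k ->
    (forall x, `|k x| <= `|h x|) ->
    rho.-integrable [set: Z] (EFin \o (fun w => k w.1 * D w)).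
  move=> mk kh; apply: le_integrable ihD => //.
    apply/measurable_EFinP/measurable_funM => //.
    exact: measurable_comp_fst.
  by move=> w _; rewrite /= lee_fin !normrM ler_wpM2r.
have mp : measurable_fun [set: X] h^\+ by exact: measurable_funrpos.
have mn : measurable_fun [set: X] h^\- by exact: measurable_funrneg.
have ip := dominated _ mp (norm_funrpos_le h).
have im := dominated _ mn (norm_funrneg_le h).
transitivity (\int[rho]_w (h^\+ w.1 * D w - h^\- w.1 * D w)).
  apply: eq_Rintegral => w _; rewrite -mulrBl; congr (_ * _).
  by rewrite -{1}[h]funrposBneg.
by rewrite RintegralB// !residual_centered_ge0 ?subrr.
Qed.

Lemma residual_variance (u : L2 nu) :
  (\int[rho]_w ((u w.1 * (w.2 - y w.1)) ^+ 2)%:E =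
   (sigma ^+ 2 * l2norm u ^+ 2)%:E)%E.
Proof.
have [_ _ _ fg] := hvar.
transitivity (\int[rho]_w ((u w.1 ^+ 2) * (w.2 - y w.1) ^+ 2)%:E)%E.
  by apply: eq_integral => w _; rewrite exprMn.
rewrite (@integral_fiber_weight _ _ _ _ _ rho fst measurable_fst
  (fun w => (w.2 - y w.1) ^+ 2) (fun=> sigma ^+ 2) _ _ _ _ fg
  (fun x => u x ^+ 2))//.
- rewrite (ge0_integral_fst (h := fun x => u x ^+ 2 * sigma ^+ 2)).
  + under eq_integral do rewrite mulrC EFinM.
    rewrite ge0_integralZl_EFin ?sqr_ge0//.
    * by rewrite -(@l2norm_sqr _ _ _ nu u) -EFinM.
    * by move=> x _; rewrite lee_fin sqr_ge0.
    * exact/measurable_EFinP/measurable_funX.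
  + by move=> x; rewrite mulr_ge0 ?sqr_ge0.
  + by apply: measurable_funM => //; exact: measurable_funX.
- by move=> w; exact: sqr_ge0.
- by move=> w; exact: sqr_ge0.
- exact: measurable_funX.
- by move=> w; exact: sqr_ge0.
- exact: measurable_funX.
Qed.

(** Y u(X) - a is the sum of W = u(X) (Y - y(X)) and V = u(X) y(X) - a, which are
    orthogonal because Y - y(X) is centred given X.  The first has second moment
    sigma^2 |u|^2, the second at least the square of its mean.  If
    Y u(X) is not square-integrable the right-hand side is infinite;
    otherwise V is square-integrable as a difference, although y u alone
    is only known to be integrable. *)
Lemma single_draw_risk (u : L2 nu) (a : R) :
  (((l2dot u y - a) ^+ 2 + sigma ^+ 2 * l2norm u ^+ 2)%:E <=
   \int[rho]_w ((w.2 * u w.1 - a) ^+ 2)%:E)%E.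
Proof.
have mPhi : measurable_fun [set: Z] (fun w : Z => w.2 * u w.1 - a).
  apply: measurable_funB => //; apply: measurable_funM.
    exact: measurable_snd.
  exact: measurable_comp_fst.
have mW : measurable_fun [set: Z] (fun w : Z => u w.1 * (w.2 - y w.1)).
  by apply: measurable_funM => //; exact: measurable_comp_fst.
have [Phioo|] :=
    ltP (\int[rho]_w ((w.2 * u w.1 - a) ^+ 2)%:E)%E +oo%E; last first.
  by apply: le_trans; rewrite leey.
have [Phi PhiE] := L2_of_Lfun (Lfun2_sqr_lty mPhi Phioo).
have Woo : (\int[rho]_w ((u w.1 * (w.2 - y w.1)) ^+ 2)%:E < +oo)%E.
  by rewrite residual_variance ltry.
have [W WE] := L2_of_Lfun (Lfun2_sqr_lty mW Woo).
pose V : L2 rho := Phi - W.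
have VE w : V w = u w.1 * y w.1 - a.
  by rewrite -[V w]/(Phi w - W w) PhiE WE; ring.
have WV : l2dot W V = 0.
  pose h x := u x * (u x * y x - a).
  rewrite -(@residual_centered h).
  - by apply: eq_Rintegral => w _; rewrite WE VE /h /=; ring.
  - apply: measurable_funM => //; apply: measurable_funB => //.
    exact: measurable_funM.
  - apply: (@eq_integrable _ _ _ rho _ measurableT _ _ _ (integrable_mul_L2 W V)).
    move=> w _.
    by rewrite WE VE /h /=; congr EFin; ring.
have WW : l2norm W ^+ 2 = sigma ^+ 2 * l2norm u ^+ 2.
  apply: EFin_inj; rewrite (@l2norm_sqr _ _ _ rho W) -residual_variance.
  by under eq_integral do rewrite WE.
have PhiWV : Phi = 1 *: W + V by rewrite scale1r /V addrC subrK.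
have PP : l2norm Phi ^+ 2 = l2norm W ^+ 2 + l2norm V ^+ 2.
  rewrite -l2dot_norm {1}PhiWV l2dotZD !(l2dotC _ Phi) PhiWV !l2dotZD.
  by rewrite !l2dot_norm (l2dotC V) WV; ring.
have EV : \int[rho]_w V w = l2dot u y - a.
  pose h x := u x * y x - a.
  have iuy := integrable_mul_L2 u y.
  have ia : nu.-integrable [set: X] (EFin \o cst a).
    exact: finite_measure_integrable_cst.
  transitivity (\int[rho]_w h w.1).
    by apply: eq_Rintegral => w _; exact: VE.
  rewrite Rintegral_fst; last exact: (integrableB measurableT iuy ia).
  rewrite /h RintegralB//; congr (_ - _).
  by rewrite Rintegral_cst// [X in fine X](@probability_setT _ _ _ nu) mulr1.
under eq_integral do rewrite -PhiE.
rewrite -(@l2norm_sqr _ _ _ rho Phi) lee_fin PP WW addrC lerD2l -EV.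
exact: Rintegral_sqr_le.
Qed.

End regression_draw.

(** * Independent observations *)

Section sample_risk.
Context d (Z : measurableType d) (R : realType).
Variables (rho : probability Z R) (phi : Z -> R) (m v : R).
Hypothesis mphi : measurable_fun [set: Z] phi.
Hypothesis v0 : 0 <= v.
Hypothesis phi_risk : forall a : R,
  (((m - a) ^+ 2 + v)%:E <= \int[rho]_z ((phi z - a) ^+ 2)%:E)%E.

Let measurable_sample_sum n (a : R) : measurable_fun [set: n.-tuple Z]
  (fun s : n.-tuple Z => (\sum_(i < n) phi (tnth s i) - a) ^+ 2).
Proof.
apply: measurable_funX; apply: measurable_funB => //.
apply: measurable_sum => i; apply: measurableT_comp => //.
exact: measurable_tnth.
Qed.

(** Conditioning on the first draw z, the bound for n draws applies with target
    a - phi z; its squared-bias term is again a one-draw risk, around a - n m.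
    The variance terms thus add up without any integrability of [phi]^2. *)
Lemma sample_sum_risk n (a : R) :
  (((n%:R * m - a) ^+ 2 + n%:R * v)%:E <=
   \int[product_power rho n]_s ((\sum_(i < n) phi (tnth s i) - a) ^+ 2)%:E)%E.
Proof.
elim: n a => [|n IHn] a.
  under eq_integral do rewrite big_ord0.
  rewrite integral_cst//.
  rewrite [X in (_ * X)%E](@probability_setT _ _ _ (product_power rho 0)).
  by rewrite mule1 !mul0r addr0.
rewrite /= ge0_integral_distribution; last 2 first.
- by apply/measurable_EFinP; exact: measurable_sample_sum.
- by move=> s; rewrite lee_fin sqr_ge0.
set F := (X in (_ <= \int[_]_x X x)%E).
have mF : measurable_fun setT F.
  apply: measurableT_comp; last exact: measurable_cons_pair.
  by apply/measurable_EFinP; exact: measurable_sample_sum.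
have F0 w : (0 <= F w)%E by rewrite lee_fin sqr_ge0.
rewrite fubini_tonelli1//.
apply: (@le_trans _ _
  (\int[rho]_z ((n%:R * m - (a - phi z)) ^+ 2 + n%:R * v)%:E)%E).
  have nv0 : (0 <= (n%:R * v)%:E)%E by rewrite lee_fin mulr_ge0.
  under eq_integral => z _.
    rewrite (_ : n%:R * m - (a - phi z) = phi z - (a - n%:R * m)); last by ring.
    rewrite EFinD; over.
  rewrite ge0_integralD//; last 2 first.
  - by move=> z _; rewrite lee_fin sqr_ge0.
  - apply/measurable_EFinP/measurable_funX; exact: measurable_funB.
  rewrite integral_cst// [X in (_ * X)%E](@probability_setT _ _ _ rho) mule1.
  have := leeD2r (n%:R * v)%:E (phi_risk (a - n%:R * m)).
  apply: le_trans.
  rewrite -EFinD lee_fin le_eqVlt; apply/orP; left; apply/eqP.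
  by rewrite -natr1; ring.
apply: ge0_le_integral => //.
- by move=> z _; rewrite lee_fin addr_ge0 ?sqr_ge0 ?mulr_ge0.
- apply/measurable_EFinP/measurable_funD => //; apply/measurable_funX.
  by apply/measurable_funB => //; exact/measurable_funB.
- exact: measurable_fun_fubini_tonelli_F.
move=> z _; apply: (le_trans (IHn (a - phi z))).
rewrite le_eqVlt; apply/orP; left; apply/eqP; apply: eq_integral => s _.
rewrite /F /= big_ord_recl /= opprB addrCA addrA.
congr ((_ + _ - _) ^+ 2)%:E; apply: eq_bigr => i _; congr phi.
exact/esym/tnthS.
Qed.

Lemma sample_mean_risk n (a : R) : (0 < n)%N ->
  (((m - a) ^+ 2 + v / n%:R)%:E <=
   \int[product_power rho n]_s
     ((n%:R^-1 * \sum_(i < n) phi (tnth s i) - a) ^+ 2)%:E)%E.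
Proof.
move=> n0; have nn0 : (n%:R : R) != 0 by rewrite pnatr_eq0 -lt0n.
under eq_integral => s _.
  rewrite (_ : _ ^+ 2 = n%:R^-1 ^+ 2 *
      (\sum_(i < n) phi (tnth s i) - n%:R * a) ^+ 2); last by field.
  rewrite EFinM; over.
rewrite ge0_integralZl_EFin ?sqr_ge0//; last 2 first.
- by move=> s _; rewrite lee_fin sqr_ge0.
- by apply/measurable_EFinP; exact: measurable_sample_sum.
have -> : (m - a) ^+ 2 + v / n%:R =
    n%:R^-1 ^+ 2 * ((n%:R * m - n%:R * a) ^+ 2 + n%:R * v) by field.
by rewrite EFinM lee_wpmul2l ?lee_fin ?sqr_ge0//; exact: sample_sum_risk.
Qed.

End sample_risk.

(** * Lower bound on the risk of the discretized estimator *)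

(** The integral of a nonnegative function is a supremum over simple functions
    below it, hence monotone for arbitrary functions.  The squared loss, as a
    function of the sample, need not be measurable when [mu] is not
    sigma-finite. *)
Lemma ge0_le_lower_integral d (T : measurableType d) (R : realType)
    (mu : {measure set T -> \bar R}) (f g : T -> \bar R) :
  (forall x, (0 <= f x)%E) -> (forall x, (f x <= g x)%E) ->
  (\int[mu]_x f x <= \int[mu]_x g x)%E.
Proof.
move=> f0 fg; have g0 x : (0 <= g x)%E by exact: le_trans (fg x).
rewrite !ge0_integralTE//; apply: ereal_sup_le => _ [h hf <-].
by exists h => // x; exact: le_trans (fg x).
Qed.

Lemma ae_dominated d (T : measurableType d) (R : realType)
    (mu mu' : {measure set T -> \bar R}) (P : T -> Prop) :
  (forall A, measurable A -> (mu' A <= mu A)%E) ->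
  {ae mu, forall t, P t} -> {ae mu', forall t, P t}.
Proof.
move=> mu'mu [N [mN N0 PN]]; exists N; split=> //.
by apply/eqP; rewrite eq_le measure_ge0 -N0 mu'mu.
Qed.

Section kernel_operator.
Context d1 d2 (T : measurableType d1) (X : measurableType d2) (R : realType).
Variables (mu : {measure set T -> \bar R}) (nu : probability X R).
Variables (L : L2 nu -> L2 mu) (l : X -> L2 mu).
Hypothesis kernelL : is_kernel_of L l.

(** The slices l(., t) as elements of [L2 nu], so that L z(t) is an inner
    product. *)
Lemma kernel_slice : exists sl : T -> L2 nu, forall t x, sl t x = l x t.
Proof.
have [_ lL2 _ _] := kernelL.
suff /choice[sl slE] : forall t, exists g : L2 nu, forall x, g x = l x t.
  by exists sl.
by move=> t; have [g gE] := L2_of_Lfun (lL2 t); exists g.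
Qed.

Variable sl : T -> L2 nu.
Hypothesis slE : forall t x, sl t x = l x t.

Lemma kernelE (z : L2 nu) : {ae mu, forall t, L z t = l2dot (sl t) z}.
Proof.
have [_ _ _ /(_ z)] := kernelL; apply: filterS => t /= /(_ I) ->.
by apply: eq_Rintegral => x _; rewrite slE.
Qed.

Lemma measurable_slice_norm :
  measurable_fun [set: T] (fun t => l2norm (sl t) ^+ 2).
Proof.
have [ml _ _ _] := kernelL; apply/measurable_EFinP.
rewrite (_ : _ \o _ = fubini_G nu (fun p : X * T => (l p.1 p.2 ^+ 2)%:E)).
  apply: measurable_fun_fubini_tonelli_G.
    exact/measurable_EFinP/measurable_funX.
  by move=> p; rewrite lee_fin sqr_ge0.
apply/funext => t; rewrite /= (@l2norm_sqr _ _ _ nu (sl t)).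
by apply: eq_integral => x _; rewrite slE.
Qed.

Variable rho : probability (X * measurableTypeR R)%type R.
Hypothesis hmarginal :
  forall B : set X, measurable B -> rho (fst @^-1` B) = nu B.
Variables (y : L2 nu) (sigma : R).
Hypothesis hmean : conditional_expectation rho (fun w => w.2) y.
Hypothesis hvar : conditional_expectation rho (fun w => (w.2 - y w.1) ^+ 2)
                    (fun=> sigma ^+ 2).

Lemma discretized_estimatorE n
    (s : n.-tuple (X * measurableTypeR R)%type) (t : T) :
  discretized_estimator l s t =
  n%:R^-1 * \sum_(i < n) ((tnth s i).2 * l (tnth s i).1 t).
Proof.
rewrite /discretized_estimator.
rewrite -[LHS]/(n%:R^-1 *
  (\sum_(i < n) ((tnth s i).2 : R) *: l (tnth s i).1 : L2 mu) t).
congr (_ * _).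
by elim/big_ind2 : _ => // a f b g <- <-.
Qed.

(** The loss dominates its part carried by the sigma-finite [mu'], for which the
    order of integration can be exchanged; for fixed t the estimator is the
    mean of n independent copies of Y l(X, t), to which [sample_mean_risk]
    applies. *)
Lemma risk_lower_bound (mu' : {sigma_finite_measure set T -> \bar R})
    (g : L2 mu) n :
  (forall A, measurable A -> (mu' A <= mu A)%E) -> (0 < n)%N ->
  (\int[mu']_t ((L y t - g t) ^+ 2 +
      sigma ^+ 2 / n%:R * l2norm (sl t) ^+ 2)%:E <=
   'E_(product_power rho n)
     [fun s => (l2norm (discretized_estimator l s - g) ^+ 2)%R])%E.
Proof.
move=> mu'mu n0; have [ml _ _ _] := kernelL.
pose Z : measurableType _ := (X * measurableTypeR R)%type.
pose err (w : n.-tuple Z * T) := discretized_estimator l w.1 w.2 - g w.2.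
have merr : measurable_fun [set: n.-tuple Z * T] (fun w => err w ^+ 2).
  apply: measurable_funX; apply: measurable_funB; last first.
    by apply: measurableT_comp => //; exact: measurable_snd.
  under eq_fun do rewrite discretized_estimatorE.
  apply: measurable_funM => //; apply: measurable_sum => i.
  apply: measurable_funM.
    apply: (@measurableT_comp _ _ _ _ _ _ (@snd X (measurableTypeR R))) => //.
    apply: (@measurableT_comp _ _ _ _ _ _ (fun s : n.-tuple Z => tnth s i)).
      exact: measurable_tnth.
    exact: measurable_fst.
  apply: (@measurableT_comp _ _ _ _ _ _ (fun p : X * T => l p.1 p.2) _
    (fun w : n.-tuple Z * T => ((tnth w.1 i).1, w.2))) => //.
  apply/measurable_fun_pairP; split; last exact: measurable_snd.
  apply: (@measurableT_comp _ _ _ _ _ _ (@fst X (measurableTypeR R))) => //.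
  apply: (@measurableT_comp _ _ _ _ _ _ (fun s : n.-tuple Z => tnth s i)).
    exact: measurable_tnth.
  exact: measurable_fst.
rewrite unlock; apply: (@le_trans _ _
  (\int[product_power rho n]_s \int[mu']_t (err (s, t) ^+ 2)%:E)%E); last first.
  apply: ge0_le_lower_integral => s.
    by apply: integral_ge0 => t _; rewrite lee_fin sqr_ge0.
  rewrite (l2norm_sqr (discretized_estimator l s - g)).
  apply: ge0_le_measure_integral => //.
    by move=> t; rewrite lee_fin sqr_ge0.
  apply/measurable_EFinP.
  exact: (measurable_funX 2 (L2_measurable (discretized_estimator l s - g))).
pose F w := (err w ^+ 2)%:E.
have mF : measurable_fun [set: n.-tuple Z * T] F by exact/measurable_EFinP.
have F0 w : (0 <= F w)%E by rewrite lee_fin sqr_ge0.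
rewrite (fubini_tonelli F)//.
apply: ae_ge0_le_integral => //.
- move=> t _; rewrite lee_fin addr_ge0 ?sqr_ge0// mulr_ge0 ?sqr_ge0//.
  by rewrite divr_ge0 ?sqr_ge0.
- apply/measurable_EFinP/measurable_funD.
    exact/measurable_funX/measurable_funB.
  by apply: measurable_funM => //; exact: measurable_slice_norm.
- by move=> t _; apply: integral_ge0 => s _.
- exact: (measurable_fun_fubini_tonelli_G F).
apply: filterS (ae_dominated mu'mu (kernelE y)) => t Lyt _.
rewrite Lyt mulrAC.
have mphi : measurable_fun [set: Z] (fun w : Z => w.2 * sl t w.1).
  apply: measurable_funM; first exact: measurable_snd.
  by apply: measurableT_comp => //; exact: measurable_fst.
have v0 : 0 <= sigma ^+ 2 * l2norm (sl t) ^+ 2 by rewrite mulr_ge0 ?sqr_ge0.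
have := @sample_mean_risk _ Z R rho (fun w => w.2 * sl t w.1)
  (l2dot (sl t) y) (sigma ^+ 2 * l2norm (sl t) ^+ 2) mphi v0
  (single_draw_risk hmarginal hmean hvar (sl t)) n (g t) n0.
move=> /le_trans; apply; rewrite le_eqVlt; apply/orP; left; apply/eqP.
apply: eq_integral => s _; rewrite /F /err discretized_estimatorE.
congr ((_ * _ - _) ^+ 2)%:E; apply: eq_bigr => i _.
by rewrite slE.
Qed.

(** [H] is the integral of |l(., t)|^2 for a sigma-finite restriction of [mu]
    that depends on [z] and [s]: it carries all the mass of L y - g, L z - L y
    and the L e_i.  It controls at once the risk from below, the propagated
    noise (Cauchy-Schwarz in each slice) and the partial Hilbert-Schmidt sums
    (Bessel in each slice). *)
Lemma risk_decomposition (g : L2 mu) (z : L2 nu) (I : choiceType)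
    (e : I -> L2 nu) (s : seq I) n :
  (forall i j, l2dot (e i) (e j) = (i == j)%:R) -> uniq s -> (0 < n)%N ->
  exists H : \bar R, [/\ (0 <= H)%E,
    ((\sum_(i <- s) l2norm (L (e i)) ^+ 2)%:E <= H)%E,
    ((l2norm (L z - L y) ^+ 2)%:E <= (l2norm (z - y) ^+ 2)%:E * H)%E &
    ((l2norm (L y - g) ^+ 2)%:E + (sigma ^+ 2 / n%:R)%:E * H <=
     'E_(product_power rho n)
       [fun s => (l2norm (discretized_estimator l s - g) ^+ 2)%R])%E].
Proof.
move=> eON us n0.
have [mu' [mu'mu mu'E]] := sigma_finite_reduction
  [:: L y - g, L z - L y & [seq L (e i) | i <- s]].
have mk := measurable_slice_norm.
have mkE : measurable_fun [set: T] (fun t => (l2norm (sl t) ^+ 2)%:E).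
  exact/measurable_EFinP.
have k0 t : (0 <= (l2norm (sl t) ^+ 2)%:E)%E by rewrite lee_fin sqr_ge0.
have aeL v : {ae mu', forall t, L v t = l2dot (sl t) v}.
  exact: ae_dominated mu'mu (kernelE v).
exists (\int[mu']_t (l2norm (sl t) ^+ 2)%:E)%E; split.
- exact: integral_ge0.
- have -> : ((\sum_(i <- s) l2norm (L (e i)) ^+ 2)%:E =
      \int[mu']_t (\sum_(i <- s) L (e i) t ^+ 2)%:E)%E.
    under [RHS]eq_integral do rewrite -sumEFin.
    rewrite ge0_integral_sum//; last 2 first.
    + by move=> i; exact/measurable_EFinP/measurable_funX.
    + by move=> i t _; rewrite lee_fin sqr_ge0.
    rewrite -sumEFin big_seq [RHS]big_seq; apply: eq_bigr => i si.
    rewrite mu'E ?l2norm_sqr//.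
    by rewrite !inE; apply/orP; right; apply/orP; right; exact: map_f.
  apply: ae_ge0_le_integral => //.
  + by move=> t _; rewrite lee_fin sumr_ge0// => i _; exact: sqr_ge0.
  + apply/measurable_EFinP/measurable_sum => i; exact: measurable_funX.
  have : {ae mu', forall t, forall i, i \in s -> L (e i) t = l2dot (sl t) (e i)}.
    elim: {us mu'E} s => [|i s IHs]; first by apply/nearW => t i; rewrite in_nil.
    apply: filterS2 (aeL (e i)) IHs => t Li Ls j.
    by rewrite inE => /predU1P[->//|]; exact: Ls.
  apply: filterS => t Lt _; rewrite lee_fin big_seq.
  under eq_bigr => i si do rewrite (Lt i si) l2dotC.
  by rewrite -big_seq l2_bessel.
- rewrite -ge0_integralZl_EFin ?sqr_ge0// l2norm_sqr -mu'E; last first.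
    by rewrite !inE eqxx orbT.
  apply: ae_ge0_le_integral => //.
  + by move=> t _; rewrite lee_fin sqr_ge0.
  + exact/measurable_EFinP/measurable_funX.
  + by move=> t _; rewrite lee_fin mulr_ge0 ?sqr_ge0.
  + by apply/measurable_EFinP/measurable_funM.
  apply: filterS2 (aeL z) (aeL y) => t Lz Ly _.
  rewrite -[X in (X ^+ 2)%:E]/(L z t - L y t) Lz Ly -l2dotB lee_fin mulrC -exprMn.
  rewrite -real_normK ?num_real//.
  by rewrite lerXn2r ?nnegrE ?mulr_ge0 ?l2norm_ge0 ?normr_ge0// l2dot_le.
- apply: le_trans (risk_lower_bound g mu'mu n0).
  rewrite l2norm_sqr -mu'E ?mem_head// -ge0_integralZl_EFin//; last first.
    by rewrite divr_ge0 ?sqr_ge0.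
  rewrite -ge0_integralD//.
  + by move=> t _; rewrite lee_fin sqr_ge0.
  + exact/measurable_EFinP/measurable_funX.
  + by move=> t _; rewrite lee_fin mulr_ge0 ?sqr_ge0// divr_ge0 ?sqr_ge0.
  + by apply/measurable_EFinP/measurable_funM.
Qed.

End kernel_operator.

(** * Operators vanishing on a basis *)

Section vanishing_on_basis.
Context d1 d2 (T : measurableType d1) (X : measurableType d2) (R : realType).
Variables (mu : {measure set T -> \bar R}) (nu : {measure set X -> \bar R}).
Variable L : L2 nu -> L2 mu.
Hypothesis blL : bounded_linear_operator L.

Let l2norm_linear_le (a : R) (f g : L2 nu) :
  l2norm (L (a *: f + g)) <= `|a| * l2norm (L f) + l2norm (L g).
Proof.
have [linL _] := blL.
by rewrite (eq_l2norm (linL a f g)) -l2normZ l2normD.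
Qed.

Lemma l2norm_operatorB (f g : L2 nu) :
  l2norm (L f - L g) = l2norm (L (f - g)).
Proof.
have [linL _] := blL.
have -> : f - g = -1 *: g + f by rewrite scaleN1r addrC.
by rewrite (eq_l2norm (linL (-1) g f)) scaleN1r addrC.
Qed.

(** The finite combinations of the basis are dense and [L] is continuous. *)
Lemma operator_vanishes_on_basis (I : choiceType) (e : I -> L2 nu) :
  orthonormal_basis e -> (forall i, l2norm (L (e i)) = 0) ->
  forall z, l2norm (L z) = 0.
Proof.
move=> [_ total] Le0 z; have [_ [C LC]] := blL.
have L0 (s : seq I) (c : I -> R) : l2norm (L (\sum_(i <- s) c i *: e i)) <= 0.
  elim: s => [|i s IHs].
    rewrite big_nil; apply: (le_trans (LC 0)).
    by rewrite -(scale0r (0 : L2 nu)) l2normZ normr0 mul0r mulr0.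
  rewrite big_cons; apply: (le_trans (l2norm_linear_le _ _ _)).
  by rewrite Le0 mulr0 add0r.
apply/eqP; rewrite eq_le l2norm_ge0 andbT leNgt; apply/negP => Lz0.
(* A residual z - u of norm below |L z| / (1 + |C|) contradicts
   |L z| <= |C| |z - u|. *)
have C1 : 0 < 1 + `|C| by rewrite ltr_wpDr.
have [s [c zu]] := total z _ (divr_gt0 Lz0 C1).
set u := \sum_(i <- s) _ in zu.
have : l2norm (L z) <= `|C| * l2norm (z - u).
  have {1}-> : z = 1 *: (z - u) + u by rewrite scale1r subrK.
  apply: (le_trans (l2norm_linear_le _ _ _)); rewrite normr1 mul1r.
  rewrite -[leRHS]addr0 lerD ?L0//; apply: (le_trans (LC _)).
  by rewrite ler_wpM2r ?l2norm_ge0 ?ler_norm.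
move: zu; rewrite ltr_pdivlMr// mulrDr mulr1 mulrC => zu Lz.
by have := l2norm_ge0 (z - u); lra.
Qed.

End vanishing_on_basis.

(** * Comparison of the two errors *)

(** Here b is the bias, q the square of the Hilbert-Schmidt norm, h the constant
    of [risk_decomposition], x the propagated noise and r the risk.  With
    m the larger of q and h, x <= delta sqrt m, and
    (b + delta sqrt m)^2 <= b^2 + v m because b / sqrt q >= b / sqrt m. *)
Lemma bias_noise_tradeoff (R : rcfType) (b q h x delta v r : R) :
  0 <= b -> 0 <= q -> 0 <= h -> 0 <= x -> 0 < delta ->
  b ^+ 2 + v * q <= r -> b ^+ 2 + v * h <= r -> x ^+ 2 <= delta ^+ 2 * h ->
  (q = 0 -> x = 0) -> delta ^+ 2 + 2 * delta * (b / Num.sqrt q) <= v ->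
  (b + x) ^+ 2 <= r.
Proof.
move=> b0 q0 h0 x0 d0 bq bh xh qx dv.
have [q00|qN0] := eqVneq q 0; first by rewrite qx// addr0; nra.
have {qN0}q0' : 0 < q by rewrite lt0r qN0.
pose m := Num.max q h.
have qm : q <= m by rewrite /m le_max lexx.
have hm : h <= m by rewrite /m le_max lexx orbT.
have bm : b ^+ 2 + v * m <= r by rewrite /m; case: (leP q h).
pose s := Num.sqrt q; pose S := Num.sqrt m.
have s0 : 0 < s by rewrite sqrtr_gt0.
have S0 : 0 <= S by exact: sqrtr_ge0.
have sS : s <= S by rewrite ler_sqrt// (le_trans q0).
have S2 : S ^+ 2 = m by rewrite sqr_sqrtr// (le_trans q0).
have xS : x <= delta * S.
  rewrite -(@ler_pXn2r _ 2) ?nnegrE//; last by rewrite mulr_ge0 ?(ltW d0).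
  by rewrite exprMn S2 (le_trans xh)// ler_wpM2l ?sqr_ge0.
have SS : S <= S ^+ 2 / s by rewrite ler_pdivlMr// expr2 ler_wpM2l.
apply: le_trans bm.
apply: (@le_trans _ _ ((b + delta * S) ^+ 2)).
  by rewrite lerXn2r ?nnegrE ?addr_ge0 ?mulr_ge0 ?(ltW d0)// lerD2l.
apply: (@le_trans _ _ (b ^+ 2 + (delta ^+ 2 + 2 * delta * (b / s)) * S ^+ 2)).
  have -> : (delta ^+ 2 + 2 * delta * (b / s)) * S ^+ 2 =
    delta ^+ 2 * S ^+ 2 + 2 * delta * b * (S ^+ 2 / s) by ring.
  have : 2 * delta * b * S <= 2 * delta * b * (S ^+ 2 / s).
    by rewrite ler_wpM2l// !mulr_ge0// ltW.
  by rewrite sqrrD exprMn; lra.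
by rewrite lerD2l -S2 ler_wpM2r ?sqr_ge0.
Qed.

(** With r the square root of v + eps^2, v = (r - eps) (r + eps), so the bound on
    delta reads delta + eps <= r. *)
Lemma noise_level_budget (R : rcfType) (delta eps v : R) :
  0 < delta -> 0 <= eps -> 0 <= v ->
  delta <= (Num.sqrt (v + eps ^+ 2) + eps)^-1 * v ->
  delta ^+ 2 + 2 * delta * eps <= v.
Proof.
move=> d0 e0 v0; set r := Num.sqrt _ => dr.
have r2 : r ^+ 2 = v + eps ^+ 2 by rewrite sqr_sqrtr// addr_ge0 ?sqr_ge0.
have r0 : 0 <= r by exact: sqrtr_ge0.
have re0 : 0 < r + eps.
  rewrite lt0r addr_ge0// andbT; apply/eqP => re; move: dr.
  by rewrite re invr0 mul0r leNgt d0.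
have v_re : v = (r - eps) * (r + eps) by rewrite -subr_sqr r2 addrK.
have : delta <= r - eps.
  by apply: (le_trans dr); rewrite v_re mulrCA mulVf ?gt_eqF// mulr1.
by move=> ?; nra.
Qed.

(** When the risk is infinite there is nothing to show.  A finite risk r bounds
    every partial Hilbert-Schmidt sum, hence the whole sum q, and
    [risk_decomposition] for the empty family supplies the remaining constant h of
    [bias_noise_tradeoff]. *)
Lemma noisy_risk_le d1 d2 (T : measurableType d1) (X : measurableType d2)
    (R : realType) (mu : {measure set T -> \bar R}) (nu : probability X R)
    (L : L2 nu -> L2 mu) (l : X -> L2 mu) (I : choiceType) (e : I -> L2 nu)
    (rho : probability (X * measurableTypeR R)%type R) (y : L2 nu) (sigma : R)
    (g : L2 mu) (z : L2 nu) (n : nat) (delta : R) :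
  bounded_linear_operator L -> is_kernel_of L l -> orthonormal_basis e ->
  (forall B : set X, measurable B -> rho (fst @^-1` B) = nu B) ->
  conditional_expectation rho (fun w => w.2) y ->
  conditional_expectation rho (fun w => (w.2 - y w.1) ^+ 2)
    (fun=> sigma ^+ 2) ->
  (0 < n)%N -> 0 < delta ->
  delta ^+ 2 + 2 * delta * (l2norm (L y - g) * (fine (hs_norm e L))^-1)
    <= sigma ^+ 2 / n%:R ->
  l2norm (z - y) <= delta ->
  ((l2norm (L z - g) ^+ 2)%:E <=
   'E_(product_power rho n)
     [fun s => (l2norm (discretized_estimator l s - g) ^+ 2)%R])%E.
Proof.
move=> blL kerL eB hmarginal hmean hvar n0 d0 budget zy.
have [sl slE] := kernel_slice kerL; have [eON _] := eB.
have dec (s : seq I) (us : uniq s) := risk_decomposition kerL slE hmarginal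
  hmean hvar g z eON us n0.
set E := ('E_ _ [ _ ])%E in dec *.
set b := l2norm (L y - g) in budget dec.
set v := sigma ^+ 2 / n%:R in budget dec.
have b0 : 0 <= b by exact: l2norm_ge0.
have v0 : 0 < v.
  apply: lt_le_trans budget; rewrite ltr_pwDl ?exprn_gt0//.
  by rewrite mulr_ge0 ?mulr_ge0 ?(ltW d0)// invr_ge0 fine_ge0// sqrte_ge0.
clearbody E.
case: E dec => [r| |] dec; first last.
- have [H [H0 _ _]] := dec [::] isT.
  by case: H H0 => [h| |]//= _; rewrite ?gt0_muley.
- by rewrite leey.
have bSr (s : seq I) : uniq s ->
    b ^+ 2 + v * \sum_(i <- s) l2norm (L (e i)) ^+ 2 <= r.
  move=> us; have [H [_ SH _ bH]] := dec s us.
  rewrite -lee_fin EFinD (EFinM v); apply: le_trans bH.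
  by rewrite leeD2l// lee_wpmul2l// lee_fin ltW.
pose a i := ((l2norm (L (e i)) ^+ 2)%:E : \bar R).
have Qle : (\esum_(i in [set: I]) a i <= ((r - b ^+ 2) / v)%:E)%E.
  apply: ge_ereal_sup => _ [F [finF _] <-].
  rewrite fsbig_finite//= sumEFin lee_fin ler_pdivlMr// lerBrDl mulrC.
  exact: bSr.
have Q0 : (0 <= \esum_(i in [set: I]) a i)%E.
  by apply: esum_ge0 => i _; rewrite lee_fin sqr_ge0.
have [q [q0 Qq]] : exists q, 0 <= q /\ (\esum_(i in [set: I]) a i = q%:E)%E.
  case: (\esum_(i in _) _)%E Q0 Qle => [q| |]// q0 _.
  by exists q.
have hsE : fine (hs_norm e L) = Num.sqrt q by rewrite /hs_norm Qq.
have bq : b ^+ 2 + v * q <= r.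
  by move: Qle; rewrite Qq lee_fin ler_pdivlMr// lerBrDl mulrC.
have [H [H0 _ xH bH]] := dec [::] isT.
case: H H0 xH bH => [h| |]// h0 xh bh; last by move: bh; rewrite gt0_muley.
rewrite lee_fin in h0; rewrite -EFinM lee_fin in xh.
rewrite -EFinM -EFinD lee_fin in bh.
have Lzg : L z - g = (L y - g) + (L z - L y) by rewrite [RHS]addrC subrKA.
rewrite lee_fin; apply: (@le_trans _ _ ((b + l2norm (L z - L y)) ^+ 2)).
  by rewrite lerXn2r ?nnegrE ?addr_ge0 ?l2norm_ge0// Lzg l2normD.
apply: (@bias_noise_tradeoff _ b q h _ delta v); rewrite ?l2norm_ge0//.
- apply: (le_trans xh); rewrite ler_wpM2r//.
  by rewrite lerXn2r ?nnegrE ?l2norm_ge0// ltW.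
- move=> q00; rewrite l2norm_operatorB//.
  apply: operator_vanishes_on_basis eB _ _ => // i.
  apply/eqP; rewrite -sqrf_eq0 eq_le sqr_ge0 andbT -lee_fin.
  rewrite -q00 -Qq; apply: esum_ge; exists [set i].
    by split => //; exact: finite_set1.
  by rewrite fsbig_set1.
- by rewrite -hsE.
Qed.

Theorem proposition6 (R : realType) (dT dX : measure_display)
    (T : measurableType dT) (X : measurableType dX)
    (mu : {measure set T -> \bar R}) (nu : probability X R)
    (A : L2 mu -> L2 nu) (hA : bounded_linear_operator A)
    (L : R -> L2 nu -> L2 mu) (hL : linear_regularization A L)
    (ell : R -> X -> L2 mu)
    (hell : forall lam : R, 0 < lam -> is_kernel_of (L lam) (ell lam))
    (I : choiceType) (e : I -> L2 nu) (he : orthonormal_basis e)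
    (y : L2 nu) (fdag : L2 mu) (hfdag : generalized_solution A y fdag)
    (hy : (A fdag : X -> R) = y %[ae nu])
    (rho : probability (X * measurableTypeR R)%type R)
    (hmarginal : forall B : set X, measurable B -> rho (fst @^-1` B) = nu B)
    (hmean : conditional_expectation rho (fun w => w.2) y)
    (sigma : R)
    (hvar : conditional_expectation rho (fun w => (w.2 - y w.1) ^+ 2)
              (fun=> sigma ^+ 2)) :
  let eps (lam : R) : R :=
    l2norm (L lam y - fdag) * (fine (hs_norm e (L lam)))^-1 in
  let star (n : nat) (lam : R) (ydelta : L2 nu) : Prop :=
    ((l2norm (L lam ydelta - fdag) ^+ 2)%:E <=
     'E_(product_power rho n)
        [fun s => (l2norm (discretized_estimator (ell lam) s - fdag) ^+ 2)%R])%E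
  in
  (exists Delta : nat -> R -> R,
    (forall (n : nat) (lam : R), (0 < n)%N -> 0 < lam ->
      Delta n lam =
        (Num.sqrt (sigma ^+ 2 / n%:R + eps lam ^+ 2) + eps lam)^-1 *
        (sigma ^+ 2 / n%:R)) /\
    (forall (n : nat) (lam : R), (0 < n)%N -> 0 < lam ->
      forall delta : R, 0 < delta -> delta <= Delta n lam ->
      forall ydelta : L2 nu, l2norm (ydelta - y) <= delta ->
      star n lam ydelta)) /\
  (exists N : R -> R -> R,
    (forall delta lam : R, 0 < delta -> 0 < lam ->
      N delta lam = sigma ^+ 2 / (delta ^+ 2 + 2 * delta * eps lam)) /\
    (forall delta lam : R, 0 < delta -> 0 < lam ->
      forall n : nat, (0 < n)%N -> n%:R <= N delta lam ->
      forall ydelta : L2 nu, l2norm (ydelta - y) <= delta ->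
      star n lam ydelta)).
Proof.
move=> eps star.
have eps0 lam : 0 <= eps lam.
  by rewrite mulr_ge0 ?l2norm_ge0// invr_ge0 fine_ge0// sqrte_ge0.
have starP n lam delta ydelta : (0 < n)%N -> 0 < lam -> 0 < delta ->
    delta ^+ 2 + 2 * delta * eps lam <= sigma ^+ 2 / n%:R ->
    l2norm (ydelta - y) <= delta -> star n lam ydelta.
  move=> n0 lam0 d0 budget yd.
  exact: (noisy_risk_le (hL.1 lam lam0) (hell lam lam0) he hmarginal hmean hvar
    n0 d0 budget yd).
split.
  exists (fun n lam =>
    (Num.sqrt (sigma ^+ 2 / n%:R + eps lam ^+ 2) + eps lam)^-1 *
    (sigma ^+ 2 / n%:R)); split=> // n lam n0 lam0 delta d0 dD ydelta.
  apply: starP => //; apply: noise_level_budget => //.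
  by rewrite divr_ge0 ?sqr_ge0.
exists (fun delta lam => sigma ^+ 2 / (delta ^+ 2 + 2 * delta * eps lam)).
split=> // delta lam d0 lam0 n n0 nN ydelta.
apply: starP => //; rewrite ler_pdivlMr ?ltr0n//.
move: nN; rewrite ler_pdivlMr; first by rewrite mulrC.
by rewrite ltr_pwDl ?exprn_gt0// mulr_ge0 ?eps0// mulr_ge0 ?(ltW d0).
Qed.
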